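(* Let $\mathcal{F}$ be a free filter on $\omega$. Then the Boolean algebra $\mathcal{A}_{\mathcal{F}}$ has the Nikodym property if and only if the quotient algebra $\mathcal{A}_{\mathcal{F}}/Fin$ has the Nikodym property and the space $N_{\mathcal{F}}$ has the finitely supported Nikodym property.
   Context: For a free filter $\mathcal{F}$ on $\omega$ (i.e. $\bigcap\mathcal{F}=\emptyset$), $\mathcal{A}_{\mathcal{F}}=\mathcal{F}\cup\{\omega\setminus A\colon A\in\mathcal{F}\}$ is the Boolean subalgebra of $\wp(\omega)$ generated by $\mathcal{F}$; it contains the ideal $Fin$ of finite subsets of $\omega$, and $\mathcal{A}_{\mathcal{F}}/Fin$ is the quotient algebra. $N_{\mathcal{F}}=\omega\cup\{p_{\mathcal{F}}\}$ is the topological space in which every point of $\omega$ is isolated and the sets $A\cup\{p_{\mathcal{F}}\}$, $A\in\mathcal{F}$, form a neighborhood base at $p_{\mathcal{F}}$. A zero-dimensional space $X$ has the finitely supported Nikodym property if every sequence $(\mu_n)$ of finitely supported real measures on $X$ (i.e. $\mu_n=\sum_{x\in F_n}\alpha_x\delta_x$, $F_n$ finite, with norm $\sum|\alpha_x|$) such that $\lim_n\mu_n(A)=0$ for every clopen $A\subseteq X$ is norm bounded. A Boolean algebra $\mathcal{A}$ has the Nikodym property if every sequence of bounded finitely additive real functions on $\mathcal{A}$ converging to $0$ at every element of $\mathcal{A}$ is bounded in the variation norm $\|\mu\|=\sup\{|\mu(A)|+|\mu(B)|\colon A\wedge B=0\}$. *)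

(* Defs.v *)
From HB Require Import structures.
From mathcomp Require Import all_boot all_order all_algebra finmap.
From mathcomp Require Import generic_quotient.
From mathcomp Require Import all_classical all_reals all_analysis.

Set Implicit Arguments.
Unset Strict Implicit.
Unset Printing Implicit Defensive.

Import Order.Theory GRing.Theory Num.Theory.
Import numFieldNormedType.Exports.

Local Open Scope classical_set_scope.
Local Open Scope ring_scope.

(* Boolean algebras are the [ctbDistrLatticeType]s of the order library. *)

Section Nikodym.
Context (R : realType) (d : Order.disp_t) (B : ctbDistrLatticeType d).
Implicit Types mu : B -> R.

Definition finitely_additive mu :=
  forall a b : B, (a `&` b = \bot)%O -> mu (a `|` b)%O = mu a + mu b.

Definition bounded_function mu := exists M : R, forall a, `|mu a| <= M.

(* [sup] is the least upper bound in [R]; it is only meaningful when [mu] is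
   bounded, which is always assumed where [variation_norm] is used. *)
Definition variation_norm mu : R :=
  sup [set r | exists a b : B, (a `&` b = \bot)%O /\ r = `|mu a| + `|mu b|].

Definition Nikodym_property :=
  forall mu : nat -> B -> R,
    (forall n, finitely_additive (mu n) /\ bounded_function (mu n)) ->
    (forall a, mu n a @[n --> \oo] --> 0) ->
    exists M : R, forall n, variation_norm (mu n) <= M.

End Nikodym.
Arguments Nikodym_property R {d} B.

Section finitely_supported_Nikodym.
Context (R : realType) (X : topologicalType).
Local Open Scope fset_scope.

(* The measure sum_(x in S) alpha_x delta_x; delta_x(A) is [\1_A x]. *)
Definition fs_measure (S : {fset X}) (alpha : X -> R) (A : set X) : R :=
  \sum_(x <- S) alpha x * \1_A x.

Definition fs_norm (S : {fset X}) (alpha : X -> R) : R :=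
  \sum_(x <- S) `|alpha x|.

Definition fs_Nikodym_property :=
  forall (S : nat -> {fset X}) (alpha : nat -> X -> R),
    (forall A : set X, clopen A ->
       fs_measure (S n) (alpha n) A @[n --> \oo] --> 0) ->
    exists M : R, forall n, fs_norm (S n) (alpha n) <= M.

End finitely_supported_Nikodym.

Section ideal_quotient.
Context (d : Order.disp_t) (B : ctbDistrLatticeType d).
Local Open Scope order_scope.

Definition is_ideal (I : set B) :=
  [/\ I \bot,
      forall a b, I b -> a <= b -> I a
    & forall a b, I a -> I b -> I (a `|` b)].

Context (I : set B) (idI : is_ideal I).

Definition quot_rel (a b : B) : bool := `[< I ((a `\` b) `|` (b `\` a)) >].

Lemma quot_relP a b : reflect (I (a `\` b) /\ I (b `\` a)) (quot_rel a b).
Proof.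
case: idI => _ Is IU; apply: (iffP (asboolP _)) => [Iab|[]]; last exact: IU.
by split; apply: Is Iab _; rewrite (leUl, leUr).
Qed.

Lemma quot_rel_refl : reflexive quot_rel.
Proof. by case: idI => I0 _ _ a; apply/quot_relP; rewrite diffxx. Qed.

Lemma quot_rel_sym : symmetric quot_rel.
Proof. by move=> a b; rewrite /quot_rel joinC. Qed.

Lemma ideal_diff_trans a b c : I (a `\` b) -> I (b `\` c) -> I (a `\` c).
Proof.
case: idI => _ Is IU Iab Ibc; apply: Is (IU _ _ Iab Ibc) _.
by rewrite leBLR joinCA diffKU joinCA diffUK joinCA leUl.
Qed.

Lemma quot_rel_trans : transitive quot_rel.
Proof.
move=> b a c /quot_relP[ab ba] /quot_relP[bc cb]; apply/quot_relP.
by split; [exact: ideal_diff_trans ab bc|exact: ideal_diff_trans cb ba].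
Qed.

Canonical quot_equiv :=
  EquivRel quot_rel quot_rel_refl quot_rel_sym quot_rel_trans.

Definition ideal_quotient : Type := {eq_quot quot_equiv}%qT.
HB.instance Definition _ := Choice.on ideal_quotient.
HB.instance Definition _ := EqQuotient.on ideal_quotient.

Local Notation Q := ideal_quotient.
Local Open Scope quotient_scope.

Lemma quot_eqP (a b : B) :
  reflect (I (a `\` b) /\ I (b `\` a)) (\pi_Q a == \pi_Q b).
Proof. by rewrite piE; exact: quot_relP. Qed.

Definition quot_meet : Q -> Q -> Q := lift_op2 Q (fun a b => a `&` b).
Definition quot_join : Q -> Q -> Q := lift_op2 Q (fun a b => a `|` b).
Definition quot_compl : Q -> Q := lift_op1 Q (fun a => ~` a).
Definition quot_le (x y : Q) : bool := quot_meet x y == x.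
Definition quot_lt (x y : Q) : bool := (y != x) && quot_le x y.

Lemma quot_repr a : I (a `\` repr (\pi_Q a)) /\ I (repr (\pi_Q a) `\` a).
Proof. by apply/quot_eqP; rewrite reprK. Qed.

Lemma quot_meetE a b : quot_meet (\pi a) (\pi b) = \pi_Q (a `&` b).
Proof.
case: idI => _ Is IU; rewrite /quot_meet; unlock; apply/eqP/quot_eqP.
have [a1 a2] := quot_repr a; have [b1 b2] := quot_repr b.
split; [apply: Is (IU _ _ a2 b2) _|apply: Is (IU _ _ a1 b1) _];
  by rewrite diffxI leU2// leBl// (leIl, leIr).
Qed.

Lemma quot_joinE a b : quot_join (\pi a) (\pi b) = \pi_Q (a `|` b).
Proof.
case: idI => _ Is IU; rewrite /quot_join; unlock; apply/eqP/quot_eqP.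
have [a1 a2] := quot_repr a; have [b1 b2] := quot_repr b.
split; [apply: Is (IU _ _ a2 b2) _|apply: Is (IU _ _ a1 b1) _];
  by rewrite diffUx leU2// leBr// (leUl, leUr).
Qed.

Lemma quot_complE a : quot_compl (\pi a) = \pi_Q (~` a).
Proof.
rewrite /quot_compl; unlock; apply/eqP/quot_eqP.
have [a1 a2] := quot_repr a; rewrite !diffE !complK in a1 a2 *.
by split; rewrite meetC.
Qed.

Lemma quot_ind (P : Q -> Prop) : (forall a, P (\pi a)) -> forall x, P x.
Proof. by move=> Ppi x; rewrite -[x]reprK. Qed.

Lemma quot_meetC : commutative quot_meet.
Proof.
by elim/quot_ind => a; elim/quot_ind => b; rewrite !quot_meetE meetC.
Qed.

Lemma quot_joinC : commutative quot_join.
Proof.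
by elim/quot_ind => a; elim/quot_ind => b; rewrite !quot_joinE joinC.
Qed.

Lemma quot_meetA : associative quot_meet.
Proof.
elim/quot_ind => a; elim/quot_ind => b; elim/quot_ind => c.
by rewrite !quot_meetE meetA.
Qed.

Lemma quot_joinA : associative quot_join.
Proof.
elim/quot_ind => a; elim/quot_ind => b; elim/quot_ind => c.
by rewrite !quot_joinE joinA.
Qed.

Lemma quot_joinKI y x : quot_meet x (quot_join x y) = x.
Proof.
elim/quot_ind: x => a; elim/quot_ind: y => b.
by rewrite quot_joinE quot_meetE joinKI.
Qed.

Lemma quot_meetKU y x : quot_join x (quot_meet x y) = x.
Proof.
elim/quot_ind: x => a; elim/quot_ind: y => b.
by rewrite quot_meetE quot_joinE meetKU.
Qed.

Lemma quot_meetUl : left_distributive quot_meet quot_join.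
Proof.
elim/quot_ind => a; elim/quot_ind => b; elim/quot_ind => c.
by rewrite !(quot_joinE, quot_meetE) meetUl.
Qed.

Lemma quot_meetxx : idempotent_op quot_meet.
Proof. by elim/quot_ind => a; rewrite quot_meetE meetxx. Qed.

HB.instance Definition _ := Order.isMeetJoinDistrLattice.Build d Q
  (le := quot_le) (lt := quot_lt) (fun _ _ => erefl) (fun _ _ => erefl)
  quot_meetC quot_joinC quot_meetA quot_joinA quot_joinKI quot_meetKU
  quot_meetUl quot_meetxx.

Lemma quot_le0x (x : Q) : \pi_Q \bot <= x.
Proof.
by elim/quot_ind: x => a; rewrite leEmeet; apply/eqP;
  rewrite [LHS]quot_meetE meet0x.
Qed.

Lemma quot_lex1 (x : Q) : x <= \pi_Q \top.
Proof.
by elim/quot_ind: x => a; rewrite leEmeet; apply/eqP;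
  rewrite [LHS]quot_meetE meetx1.
Qed.

HB.instance Definition _ := Order.hasBottom.Build d Q quot_le0x.
HB.instance Definition _ := Order.hasTop.Build d Q quot_lex1.

Lemma quot_joinxC (x : Q) : x `|` quot_compl x = \top.
Proof.
by elim/quot_ind: x => a; rewrite quot_complE [LHS]quot_joinE joinxC.
Qed.

Lemma quot_meetxC (x : Q) : x `&` quot_compl x = \bot.
Proof.
by elim/quot_ind: x => a; rewrite quot_complE [LHS]quot_meetE meetxC.
Qed.

HB.instance Definition _ :=
  Order.TBDistrLattice_hasComplement.Build d Q quot_joinxC quot_meetxC.

End ideal_quotient.

Definition filter_or_dual (F : set_system nat) : set_system nat :=
  F `|` [set ~` A | A in F].

(* [filter_algebra] and [filter_space] carry the filter proof as a parameter so
   that the Boolean algebra and topological structures can be found from the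
   carrier alone. *)
Definition filter_algebra (F : set_system nat) (FF : ProperFilter F) : Type :=
  {A : set nat | A \in filter_or_dual F}.

(* [Some n] is the point n of omega, [None] is the point p_F. *)
Definition filter_space (F : set_system nat) (FF : ProperFilter F) : Type :=
  option nat.

Section filter_algebra.
Context (F : set_system nat) (FF : ProperFilter F).
Local Notation filter_or_dual := (filter_or_dual F).
Local Notation filter_algebra := (filter_algebra FF).

Lemma filter_or_dualC A : filter_or_dual A -> filter_or_dual (~` A).
Proof. by case=> [FA|[B FB <-]]; [right; exists A|left; rewrite setCK]. Qed.

Lemma filter_or_dualI A B :
  filter_or_dual A -> filter_or_dual B -> filter_or_dual (A `&` B).
Proof.
move=> [FA|[A' FA' <-]] [FB|[B' FB' <-]].
- by left; exact: filterI.
- by right; exists (~` A `|` B'); [exact: filterS FB'|rewrite setCU setCK].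
- by right; exists (A' `|` ~` B); [exact: filterS FA'|rewrite setCU setCK].
- by right; exists (A' `|` B'); [exact: filterS FA'|rewrite setCU].
Qed.

HB.instance Definition _ := SubChoice.on filter_algebra.

Let SP : {pred set nat} := fun A => A \in filter_or_dual.

Let closedI : {in SP &, forall A B, (A `&` B)%O \in SP}.
Proof.
by move=> A B /set_mem FA /set_mem FB; exact/mem_set/filter_or_dualI.
Qed.

Let closedU : {in SP &, forall A B, (A `|` B)%O \in SP}.
Proof.
move=> A B /set_mem FA /set_mem FB; apply/mem_set.
rewrite -[(A `|` B)%O]setCK [(_ `|` _)%O]/(_ `|` _) setCU.
by apply/filter_or_dualC/filter_or_dualI; exact: filter_or_dualC.
Qed.

Let closed0 : (\bot : set nat)%O \in SP.
Proof. by apply/mem_set; right; exists setT; [exact: filterT|exact: setCT]. Qed.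

Let closed1 : (\top : set nat)%O \in SP.
Proof. by apply/mem_set; left; exact: filterT. Qed.

HB.instance Definition _ := Order.SubChoice_isTBSubLattice.Build
  _ _ SP set_display filter_algebra closedI closedU closed0 closed1.

Lemma filter_algebra_meetUl :
  @left_distributive filter_algebra filter_algebra Order.meet Order.join.
Proof. by move=> a b c; apply: val_inj; exact: setIUl. Qed.

HB.instance Definition _ := Order.Lattice_Meet_isDistrLattice.Build
  set_display filter_algebra filter_algebra_meetUl.

Definition filter_algebra_compl (a : filter_algebra) : filter_algebra :=
  exist _ (~` val a) (mem_set (filter_or_dualC (set_mem (valP a)))).

Lemma filter_algebra_joinxC a : (a `|` filter_algebra_compl a)%O = \top%O.
Proof. by apply: val_inj; exact: setUCr. Qed.

Lemma filter_algebra_meetxC a : (a `&` filter_algebra_compl a)%O = \bot%O.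
Proof. by apply: val_inj; exact: setICr. Qed.

HB.instance Definition _ := Order.TBDistrLattice_hasComplement.Build
  set_display filter_algebra filter_algebra_joinxC filter_algebra_meetxC.

Definition Fin : set filter_algebra := [set a | finite_set (val a)].

Lemma Fin_ideal : is_ideal Fin.
Proof.
split=> [|a b fb|a b fa fb]; first exact: finite_set0.
- by rewrite -[(a <= b)%O]/(val a <= val b)%O subsetEset => /sub_finite_set; apply.
- by rewrite /Fin/= finite_setU.
Qed.

End filter_algebra.

Section filter_space.
Context (F : set_system nat) (FF : ProperFilter F).
Local Notation filter_space := (filter_space FF).

HB.instance Definition _ := Choice.on filter_space.

Definition filter_space_nbhs (x : filter_space) : set_system filter_space :=
  match x with
  | Some n => [set U | U (Some n)]
  | None => [set U | exists2 A, F A & Some @` A `|` [set None] `<=` U]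
  end.

HB.instance Definition _ := hasNbhs.Build filter_space filter_space_nbhs.

Lemma filter_space_nbhs_filter (x : filter_space) : ProperFilter (nbhs x).
Proof.
apply: Build_ProperFilter_ex; case: x => [n|].
- by move=> U Un; exists (Some n).
- by move=> U [A _ AU]; exists None; apply: AU; right.
- by split=> [//|U V Un Vn|U V UV]; [split|exact: UV].
- split=> [|U V [A FA AU] [B FB BV]|U V UV [A FA AU]].
  + by exists setT => //; exact: filterT.
  + exists (A `&` B); first exact: filterI.
    move=> _ [[n [An Bn] <-]|->].
      by split; [apply: AU|apply: BV]; left; exists n.
    by split; [apply: AU|apply: BV]; right.
  + by exists A => // y /AU /UV.
Qed.

Lemma filter_space_nbhs_singleton (x : filter_space) (U : set filter_space) :
  nbhs x U -> U x.
Proof. by case: x => [n//|[A _]]; apply; right. Qed.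

Lemma filter_space_nbhs_nbhs (x : filter_space) (U : set filter_space) :
  nbhs x U -> nbhs x (nbhs^~ U).
Proof.
case: x => [n//|[A FA AU]]; exists A => // _ [[n An <-]|->]; last by exists A.
by apply: AU; left; exists n.
Qed.

HB.instance Definition _ := Nbhs_isNbhsTopological.Build filter_space
  filter_space_nbhs_filter filter_space_nbhs_singleton filter_space_nbhs_nbhs.

End filter_space.

(* Main.v *)
Require Import Defs.
From mathcomp Require Import all_boot all_order all_algebra finmap.
From mathcomp Require Import generic_quotient lra.
From mathcomp Require Import all_classical all_reals all_analysis.

(* From [A_F] to the other two: charges on the quotient pull back to [A_F], and
   the clopen subsets of [N_F] are exactly the elements of [A_F].

   Conversely let [mu_n] be charges on [A_F], pointwise bounded, and put
   [a_n k := mu_n {k}]. Below the complement of a set of [F] the algebra is a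
   full power set, where a gliding hump shows that the [mu_n] are uniformly
   bounded on finite sets. Hence the measures obtained by truncating
   [sum_k a_n k delta_k] and balancing the total mass at [p_F] are pointwise
   bounded on clopen sets, and the property of [N_F] gives
   [sup_n sum_k |a_n k| < oo]. So the atomic parts of the [mu_n] are uniformly
   bounded; the remainders vanish on finite sets, live on [A_F / Fin] and are
   still pointwise bounded, hence bounded by the property of the quotient. *)

Set Implicit Arguments.
Unset Strict Implicit.
Unset Printing Implicit Defensive.

Import Order.Theory GRing.Theory Num.Theory.
Import numFieldNormedType.Exports.

Local Open Scope classical_set_scope.
Local Open Scope ring_scope.

(** * Charges on a power set and small subsequences *)

Section set_charge.
Context (R : realType) (T : Type) (m : set T -> R).
Hypothesis madd : finitely_additive m.

Lemma charge_setU A B : A `&` B = set0 -> m (A `|` B) = m A + m B.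
Proof. exact: madd. Qed.

Lemma charge_set0 : m set0 = 0.
Proof.
have := charge_setU (set0I (@set0 T)); rewrite setU0 => h.
by apply: (addrI (m set0)); rewrite addr0 -h.
Qed.

Lemma charge_setIC A B : m A = m (A `&` B) + m (A `&` ~` B).
Proof.
rewrite -charge_setU; last by rewrite setIACA setICr setI0.
by rewrite -setIUr setUCr setIT.
Qed.

(* The total variation is superadditive, so one of the even and odd halves
   of an injective sequence carries at most half of it. *)
Lemma charge_small_subsequence (f : nat -> T) (e : R) :
    injective f -> bounded_function m -> 0 < e ->
  exists2 g : nat -> nat, injective g &
    forall B : set nat, `|m ((f \o g) @` B)| <= e.
Proof.
move=> finj [M mM] e0.
(* Over disjoint [B] and [C] the supremum of these differences is the total variation along
   [f \o g]; each of the [k] halvings divides its bound by 2. *)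
suff H (k : nat) : exists2 g : nat -> nat, injective g & forall B C : set nat,
    B `&` C = set0 ->
    (m ((f \o g) @` B) - m ((f \o g) @` C)) * 2 ^+ k <= 2 * M.
  have [k ke] : exists k : nat, 2 * M <= e * 2 ^+ k.
    have [k hk] : exists k : nat, 2 * M / e <= k%:R.
      exists (Num.truncn (2 * M / e)).+1; apply: ltW.
      exact: truncnS_gt.
    exists k; rewrite [leRHS]mulrC -ler_pdivrMr// (le_trans hk)//.
    by rewrite -natrX ler_nat ltnW// ltn_expl.
  have [g ginj gM] := H k; exists g => // B.
  have k0 : 0 < 2 ^+ k :> R by rewrite exprn_gt0.
  have h1 := gM B set0 (setI0 _); have h2 := gM set0 B (set0I _).
  rewrite !image_set0 !charge_set0 in h1 h2.
  rewrite ler_norml lerNl; apply/andP; split; rewrite -(ler_pM2r k0);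
    apply: le_trans ke; by rewrite ?sub0r ?subr0 in h1 h2.
elim: k => [|k [g ginj IH]].
  exists id => // B C _; rewrite expr0 mulr1 mulr2n mulrDl mul1r.
  by have := mM (f @` B); have := mM (f @` C); rewrite !ler_norml; lra.
have odd_even (i j : nat) : i.*2.+1 <> j.*2.
  by move=> /(congr1 odd) /=; rewrite !odd_double.
pose ev := @double; pose od i := i.*2.+1.
have evinj : injective ev by move=> i j /double_inj.
have odinj : injective od by move=> i j [] /double_inj.
have [hev|] := pselect (forall B C : set nat, B `&` C = set0 ->
    (m ((f \o (g \o ev)) @` B) - m ((f \o (g \o ev)) @` C)) * 2 ^+ k.+1
      <= 2 * M).
  by exists (g \o ev) => //; exact: inj_comp.
(* A pair violating the bound on the even half, joined with one violating it on the odd half, would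
   contradict the induction hypothesis at [k]. *)
move=> /existsNP[B1 /existsNP[C1 /not_implyP[BC1 /negP]]]; rewrite -ltNge => h1.
exists (g \o od); first exact: inj_comp.
move=> B C BC; rewrite leNgt; apply/negP => h2.
have IHd := IH (ev @` B1 `|` od @` B) (ev @` C1 `|` od @` C).
have fginj : injective (f \o g) by exact: inj_comp.
have disj (X Y : set nat) :
    ((f \o g) @` (ev @` X)) `&` ((f \o g) @` (od @` Y)) = set0.
  by rewrite -subset0 => _ [[_ [x _ <-] <-] [_ [y _ <-]]] /fginj /odd_even.
rewrite 2!image_setU !charge_setU ?disj// in IHd.
rewrite !image_comp in IHd.
have : (ev @` B1 `|` od @` B) `&` (ev @` C1 `|` od @` C) = set0.
  rewrite -subset0 => z [[[x B1x <-]|[x Bx <-]] [[y Cy]|[y Cy]]].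
  - move=> /evinj yx; rewrite {}yx in Cy.
    by have := conj B1x Cy : (B1 `&` C1) x; rewrite BC1.
  - by move/odd_even.
  - by move/esym/odd_even.
  - move=> /odinj yx; rewrite {}yx in Cy.
    by have := conj Bx Cy : (B `&` C) x; rewrite BC.
move=> /IHd; rewrite exprS in h1 h2; move: h1 h2.
rewrite -[f \o (g \o ev)]/(f \o g \o ev) -[f \o (g \o od)]/(f \o g \o od).
move: (m _) (m _) (m _) (m _) (2 ^+ k) => b1 c1 b c t h1 h2; lra.
Qed.

End set_charge.

(** * The gliding hump *)

Lemma nat_bound_ex (R : realType) (P : R -> Prop) :
  (exists M, P M) -> exists n : nat, exists2 M, P M & M <= n%:R.
Proof.
move=> [M PM]; exists (Num.truncn M).+1, M => //; apply: ltW.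
exact: truncnS_gt.
Qed.

Lemma injective_unbounded (f : nat -> nat) (t : nat) :
  injective f -> exists i, (t <= f i)%N.
Proof.
move=> finj; apply: contrapT => /forallNP ft.
have ft' i : (f i < t)%N by rewrite ltnNge; apply/negP/ft.
pose g (i : 'I_t.+1) : 'I_t := Ordinal (ft' i).
have ginj : injective g by move=> i j [] /finj /val_inj.
by have := leq_card g ginj; rewrite !card_ord ltnn.
Qed.

Section gliding_hump.
Context (R : realType) (m : nat -> set nat -> R).
Hypothesis madd : forall n, finitely_additive (m n).
Hypothesis mbnd : forall n, bounded_function (m n).
Hypothesis mptw : forall A, exists M : R, forall n, `|m n A| <= M.

(** A state holds an enumeration of the indices still available and a threshold. A step picks an
    index beyond the threshold, thins the enumeration until that index's charge is small on all of
    its subsets, and raises the threshold to absorb the mass of the new singleton under every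
    charge. Injectivity is a premise inside the existential so that [choice] gives a total step
    function; for other states the triple is a dummy. *)
Lemma gliding_hump_step (s : (nat -> nat) * nat) :
  exists p : nat * (nat -> nat) * nat, injective s.1 ->
    [/\ injective p.1.2, range s.1 p.1.1, range p.1.2 `<=` range s.1,
        forall B, `|m p.1.1 (p.1.2 @` B)| <= 1 &
        [/\ (s.2 <= p.1.1)%N, (p.1.1 < p.2)%N &
        forall n, `|m n [set p.1.1]| + 1 + s.2%:R <= p.2%:R]].
Proof.
case: s => f t /=.
have [finj|nf] := pselect (injective f); last by exists (0%N, id, 0%N).
have [i fi] := injective_unbounded t finj.
have [g ginj gB] :=
  charge_small_subsequence (madd (f i)) finj (mbnd (f i)) (@ltr01 R).
have [C [M mM MC]] := nat_bound_ex (mptw [set f i]).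
exists (f i, f \o g, (C + 1 + t + (f i).+1)%N) => _ /=; split.
- exact: inj_comp.
- by exists i.
- by move=> _ [k _ <-]; exists (g k).
- exact: gB.
- split=> [//||n]; first by rewrite leq_addl.
  rewrite !natrD (le_trans (_ : _ <= C%:R + 1 + t%:R))//.
    by rewrite !lerD2r (le_trans (mM n)).
  by rewrite lerDl.
Qed.

(** Let [J k] be the chosen indices and [t] the threshold before step [k]. The charge [m (J k)]
    splits [range J] into earlier indices, worth at most [t - k - 1], later ones, worth at most 1,
    and [J k] itself, worth at least [J k >= t]. Its value on the fixed set [range J] is thus at
    least [k] in absolute value, against pointwise boundedness. *)
Lemma no_diagonal_hump : ~ forall j : nat, j%:R <= `|m j [set j]|.
Proof.
move=> mj; have [G HG] := choice gliding_hump_step.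
pose next s := ((G s).1.2, (G s).2).
(* The initial threshold 1 is what [mpre] requires at [k = 0]. *)
pose st k := iter k next (id, 1%N).
pose J k := (G (st k)).1.1.
have stinj k : injective (st k).1.
  by elim: k => [|k IH]; [exact: (@inj_id nat)|case: (HG _ IH)].
have stS k i : (k <= i)%N -> range (st i).1 `<=` range (st k).1.
  move=> /subnK <-; elim: (i - k)%N => // d IH; apply: subset_trans IH.
  by rewrite addSn; case: (HG _ (stinj (d + k)%N)).
have Jlt i k : (i < k)%N -> (J i < (st k).2)%N.
  elim: k => // k IH; rewrite ltnS leq_eqVlt => /predU1P[->|ik].
    by case: (HG _ (stinj k)) => _ _ _ _ [].
  apply: leq_trans (IH ik) _.
  have [_ _ _ _ [h1 h2 _]] := HG _ (stinj k).
  exact: leq_trans h1 (ltnW h2).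
have JJ i k : (i < k)%N -> (J i < J k)%N.
  move=> /Jlt /leq_trans; apply.
  by case: (HG _ (stinj k)) => _ _ _ _ [].
pose pre k := J @` `I_k; pose post k := J @` [set i | (k < i)%N].
have preS k : pre k.+1 = pre k `|` [set J k].
  by rewrite /pre IIS image_setU image_set1.
have preJ k : pre k `&` [set J k] = set0.
  by rewrite -subset0 => _ [[i /JJ ik <-]] /= e; rewrite e ltnn in ik.
have mpre n k : `|m n (pre k)| + k%:R + 1 <= (st k).2%:R.
  elim: k => [|k IH].
    by rewrite /pre II0 image_set0 charge_set0// normr0 !add0r.
  rewrite preS charge_setU// -natr1.
  have [_ _ _ _ [_ _ /(_ n)]] := HG _ (stinj k).
  have := ler_normD (m n (pre k)) (m n [set J k]).
  rewrite -/(J k) -[(G (st k)).2]/((st k.+1).2).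
  by move: IH; lra.
(* All later indices lie in the enumeration thinned for [J k]. *)
have mpost k : `|m (J k) (post k)| <= 1.
  have [_ _ _ h _] := HG _ (stinj k).
  suff -> : post k = (G (st k)).1.2 @` ((G (st k)).1.2 @^-1` post k).
    exact: h.
  apply/seteqP; split; last exact: image_preimage_subset.
  suff h' : post k `<=` range (G (st k)).1.2.
    by move=> x px; have [y _ yx] := h' x px; exists y => //=; rewrite yx.
  move=> _ [i /= ki <-].
  have [_ Ji _ _ _] := HG _ (stinj i).
  exact: (stS _ _ ki).
have [C [M mM MC]] := nat_bound_ex (mptw (range J)).
have rJ k : range J = pre k.+1 `|` post k.
  rewrite /pre /post -image_setU; congr (_ @` _).
  apply/seteqP; split=> // i _ /=; rewrite ltnS.
  by case: leqP; [left|right].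
have post_disj k : pre k.+1 `&` post k = set0.
  rewrite -subset0 => _ [[i /= ik <-]] [j /= kj e].
  by have := JJ i j (leq_trans ik kj); rewrite e ltnn.
pose k := C.+1.
have := mM (J k); rewrite (rJ k) charge_setU ?post_disj// preS.
rewrite charge_setU ?preJ//.
have := mpre (J k) k; have := mpost k; have := mj (J k).
have [_ _ _ _ [+ _ _]] := HG _ (stinj k).
rewrite -/(J k) -(ler_nat R) => h0 h1 h2 h3 h4.
have : k%:R = C%:R + 1 :> R by rewrite /k -natr1.
have : `|m (J k) [set J k]| <= `|m (J k) (pre k) + m (J k) [set J k] +
   m (J k) (post k)| + `|m (J k) (pre k)| + `|m (J k) (post k)|.
  set a := m _ _; set b := m _ _; set c := m _ _.
  have {1}-> : a = (b + a + c) - b - c by lra.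
  apply: (le_trans (ler_normB _ _)); apply: lerD => //; exact: ler_normB.
by lra.
Qed.

End gliding_hump.

(** * Uniform bounds on finite sets *)

Lemma finite_set_sub_II (S : set nat) :
  finite_set S -> exists N, S `<=` `I_N.
Proof.
move=> /finite_fsetP[X ->]; exists (\max_(i <- X) i).+1 => i /= iX.
by rewrite ltnS; apply: leq_bigmax_seq.
Qed.

Section finite_sets.
Context (R : realType) (m : nat -> set nat -> R).
Hypothesis madd : forall n, finitely_additive (m n).
Hypothesis mbnd : forall n, bounded_function (m n).
Hypothesis mptw : forall A, exists M : R, forall n, `|m n A| <= M.

Lemma charge_bounded_II N :
  exists M : R, forall n B, B `<=` `I_N -> `|m n B| <= M.
Proof.
elim: N => [|N [M IH]].
  exists 0 => n B; rewrite II0 subset0 => ->.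
  by rewrite charge_set0// normr0.
have [C mC] := mptw [set N]; exists (M + C) => n B BN.
rewrite (charge_setIC (madd n) B `I_N) (le_trans (ler_normD _ _))// lerD//.
  by apply: IH; exact: subIsetr.
have /subset_set1[->|->] : B `&` ~` `I_N `<=` [set N].
- move=> i [/BN /=]; rewrite ltnS => iN /negP; rewrite -leqNgt => Ni.
  by apply/eqP; rewrite eqn_leq iN.
- by rewrite charge_set0// normr0 (le_trans _ (mC n)).
- exact: mC.
Qed.

(** Otherwise there are finite blocks in successive intervals, the [k]-th having value at least [k]
    under some charge of the family. Treating each block as a single point gives charges excluded by
    [no_diagonal_hump]. *)
Lemma charge_bounded_finite :
  exists M : R, forall n S, finite_set S -> `|m n S| <= M.
Proof.
apply: contrapT => /forallNP unb.
have step (s : nat * nat) : exists p : nat * set nat * nat,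
    [/\ p.1.2 `<=` [set i | (s.1 <= i < p.2)%N], (s.1 <= p.2)%N &
        s.2%:R <= `|m p.1.1 p.1.2|].
  case: s => N K /=; have [D mD] := charge_bounded_II N.
  (* The surplus [D] pays for discarding the part of [S] below [N]; the rest still has value at
     least [K]. *)
  have /existsNP[n /existsNP[S /not_implyP[fS /negP]]] := unb (D + K%:R).
  rewrite -ltNge => mS; have [N' SN'] := finite_set_sub_II fS.
  exists (n, S `&` ~` `I_N, maxn N N'); split=> /=.
  - move=> i [/SN' /= iN' /negP]; rewrite -leqNgt => Ni.
    by rewrite Ni leq_max iN' orbT.
  - by rewrite leq_maxl.
  - have := mD n (S `&` `I_N) (@subIsetr _ _ _).
    move: mS; rewrite (charge_setIC (madd n) S `I_N).
    have := ler_normD (m n (S `&` `I_N)) (m n (S `&` ~` `I_N)).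
    by lra.
have [G HG] := choice step.
pose Nf := fix Nf k := if k is k'.+1 then (G (Nf k', k')).2 else 0%N.
pose S k := (G (Nf k, k)).1.2; pose nn k := (G (Nf k, k)).1.1.
have NfS : {homo Nf : i j / (i <= j)%N}.
  apply: homo_leq => // [j i k|k]; first exact: leq_trans.
  by case: (HG (Nf k, k)).
have SN k i : S k i -> (Nf k <= i < Nf k.+1)%N.
  by case: (HG (Nf k, k)) => + _ _; exact.
have Sdisj j k i : S j i -> S k i -> j = k.
  move=> /SN /andP[j1 j2] /SN /andP[k1 k2].
  case: (ltngtP j k) => // /NfS h.
    by have := leq_trans j2 (leq_trans h k1); rewrite ltnn.
  by have := leq_trans k2 (leq_trans h j1); rewrite ltnn.
pose m' j (A : set nat) := m (nn j) (\bigcup_(i in A) S i).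
apply: (@no_diagonal_hump R m').
- move=> j A B AB; rewrite /m' -[(A `|` B)%O]/(A `|` B) bigcup_setU.
  apply: charge_setU => //; rewrite -subset0 => x [[i Ai Six] [k Bk Skx]].
  have : (A `&` B) i by split=> //; rewrite (Sdisj _ _ _ Six Skx).
  by rewrite [A `&` B]AB.
- by move=> j; have [M mM] := mbnd (nn j); exists M => A; exact: mM.
- move=> A; have [M mM] := mptw (\bigcup_(i in A) S i).
  by exists M => j; exact: mM.
- by move=> j; rewrite /m' bigcup_set1; case: (HG (Nf j, j)).
Qed.

End finite_sets.

(** * From null sequences to pointwise bounded families *)

(* Dividing the k-th member of a badly unbounded subfamily by [k.+1] makes it
   pointwise null but keeps it unbounded, so null sequences may be replaced by
   pointwise bounded families in Nikodym-type properties. *)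
Lemma bounded_by_rescaling (R : realType) (I U W : Type)
    (x : I -> U -> R) (y : I -> W -> R) :
  (forall s : nat -> I, (forall u, x (s k) u / k.+1%:R @[k --> \oo] --> 0) ->
    exists M : R, forall k w, y (s k) w / k.+1%:R <= M) ->
  (forall u, exists M : R, forall i, `|x i u| <= M) ->
  exists M : R, forall i w, y i w <= M.
Proof.
move=> nik ptw; apply: contrapT => /forallNP unb.
(* The square survives the division: the rescaled values are still at least [k.+1]. *)
have big (k : nat) : exists p : I * W, k.+1%:R * k.+1%:R <= y p.1 p.2.
  have /existsNP[i /existsNP[w /negP]] := unb (k.+1%:R * k.+1%:R).
  by rewrite -ltNge => /ltW h; exists (i, w).
have [p hp] := choice big.
have [u|M0 hM0] := nik (fst \o p).
  have [M hM] := ptw u.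
  have h : (M * harmonic k : R) @[k --> \oo] --> 0.
    rewrite -(mulr0 M); apply: cvgM; [exact: cvg_cst|exact: cvg_harmonic].
  have h' : (- (M * harmonic k) : R) @[k --> \oo] --> 0.
    by rewrite -oppr0; exact: cvgN.
  apply: (squeeze_cvgr _ h' h).
  apply: nearW => k; rewrite -ler_norml normrM normfV normr_nat.
  by rewrite /harmonic ler_wpM2r.
have [|C [M hM MC]] := @nat_bound_ex R (fun M => forall k w,
    y ((fst \o p) k) w / k.+1%:R <= M); first by exists M0.
have := le_trans (hM C (p C).2) MC; rewrite ler_pdivrMr// => h.
have := le_trans (hp C) h.
by rewrite ler_pM2r// ler_nat ltnn.
Qed.

Section boolean_charge.
Context (R : realType) (d : Order.disp_t) (B : ctbDistrLatticeType d).
Implicit Types mu : B -> R.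

Lemma charge_bot mu : finitely_additive mu -> mu \bot%O = 0.
Proof.
move=> muD; have := muD \bot%O \bot%O (meetx0 _); rewrite joinx0 => h.
by apply: (addrI (mu \bot%O)); rewrite addr0 -h.
Qed.

Lemma charge_diff mu (a b : B) : finitely_additive mu ->
  mu a = mu (a `&` b)%O + mu (a `\` b)%O.
Proof.
move=> muD; rewrite -muD ?joinIB//.
by rewrite diffE meetACA meetxC meetx0.
Qed.

Lemma ler_variation_norm mu (a : B) :
  bounded_function mu -> `|mu a| <= variation_norm mu.
Proof.
move=> [M muM]; apply: (@le_trans _ _ (`|mu a| + `|mu \bot%O|)).
  by rewrite lerDl.
apply: ub_le_sup; last by exists a, \bot%O; rewrite meetx0.
by exists (M + M) => _ [b [c [_ ->]]]; rewrite lerD.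
Qed.

Lemma variation_norm_le mu (M : R) :
  (forall a, `|mu a| <= M) -> variation_norm mu <= M + M.
Proof.
move=> muM; apply: ge_sup.
  by exists (`|mu \bot%O| + `|mu \bot%O|), \bot%O, \bot%O; rewrite meetx0.
by move=> _ [b [c [_ ->]]]; rewrite lerD.
Qed.

(** Together with [Nikodym_property_intro] this turns the property into a uniform boundedness
    principle for values; the variation norm lies between the supremum of the absolute values and
    twice it. *)
Lemma Nikodym_bounded (I : Type) (mu : I -> B -> R) :
  Nikodym_property R B ->
  (forall i, finitely_additive (mu i) /\ bounded_function (mu i)) ->
  (forall a, exists M : R, forall i, `|mu i a| <= M) ->
  exists M : R, forall i a, `|mu i a| <= M.
Proof.
move=> nik muP; apply: (@bounded_by_rescaling R I B B mu) => s mus.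
have [||M hM] := nik (fun k a => mu (s k) a / k.+1%:R); last 1 first.
- exists M => k a; apply: le_trans (hM k).
  have -> : `|mu (s k) a| / k.+1%:R = `|mu (s k) a / k.+1%:R|.
    by rewrite normrM normfV normr_nat.
  apply: (@ler_variation_norm (fun a => mu (s k) a / k.+1%:R)).
  have [_ [C hC]] := muP (s k); exists (C / k.+1%:R) => b.
  by rewrite normrM normfV normr_nat ler_wpM2r.
- move=> k; have [muD [C hC]] := muP (s k); split.
    by move=> a b ab; rewrite muD// mulrDl.
  exists (C / k.+1%:R) => b.
  by rewrite normrM normfV normr_nat ler_wpM2r.
- exact: mus.
Qed.

Lemma Nikodym_property_intro :
  (forall mu : nat -> B -> R,
    (forall n, finitely_additive (mu n) /\ bounded_function (mu n)) ->
    (forall a, exists M : R, forall n, `|mu n a| <= M) ->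
    exists M : R, forall n a, `|mu n a| <= M) ->
  Nikodym_property R B.
Proof.
move=> H mu muP mu0; have [//|a|M hM] := H mu.
  have /cvgP/cvg_seq_bounded[C [_ hC]] := mu0 a.
  by exists (C + 1) => n; apply: hC => //; rewrite ltrDl.
by exists (M + M) => n; exact: variation_norm_le.
Qed.

End boolean_charge.

(** The index type is arbitrary because the measures used later are indexed by pairs of a charge and
    a truncation length. *)
Lemma fs_Nikodym_bounded (R : realType) (X : topologicalType) (I : Type)
    (S : I -> {fset X}) (alpha : I -> X -> R) :
  fs_Nikodym_property R X ->
  (forall A : set X, clopen A ->
    exists M : R, forall i, `|fs_measure (S i) (alpha i) A| <= M) ->
  exists M : R, forall i, fs_norm (S i) (alpha i) <= M.
Proof.
move=> nik ptw.
suff [M hM] : exists M : R, forall i (_ : unit), fs_norm (S i) (alpha i) <= M.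
  by exists M => i; exact: hM.
apply: (@bounded_by_rescaling R I {A : set X | clopen A} unit
  (fun i A => fs_measure (S i) (alpha i) (sval A))); last first.
  by move=> [A cA]; exact: ptw.
move=> s hs.
have [|M hM] := nik (S \o s) (fun k x => alpha (s k) x / k.+1%:R).
  move=> A cA; have := hs (exist _ A cA); apply: cvg_trans => /=.
  apply: near_eq_cvg; apply: nearW => k; rewrite /fs_measure mulr_suml.
  by apply: eq_bigr => x _; rewrite mulrAC.
exists M => k _; apply: le_trans (hM k); rewrite /fs_norm mulr_suml ler_sum//.
by move=> x _; rewrite normrM normfV normr_nat.
Qed.

(** * Charges on the quotient by an ideal *)

Section quotient_charge.
Context (R : realType) (d : Order.disp_t) (B : ctbDistrLatticeType d).
Context (I : set B) (idI : is_ideal I).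
Local Notation Q := (ideal_quotient idI).
Local Open Scope quotient_scope.

Lemma pi_meet (a b : B) : \pi_Q (a `&` b)%O = (\pi_Q a `&` \pi_Q b)%O.
Proof. by rewrite -[RHS]/(quot_meet _ _) quot_meetE. Qed.

Lemma pi_join (a b : B) : \pi_Q (a `|` b)%O = (\pi_Q a `|` \pi_Q b)%O.
Proof. by rewrite -[RHS]/(quot_join _ _) quot_joinE. Qed.

Lemma Nikodym_quotient : Nikodym_property R B -> Nikodym_property R Q.
Proof.
move=> nik; apply: Nikodym_property_intro => mu muP ptw.
have [n|a|M hM] := Nikodym_bounded (mu := fun n a => mu n (\pi_Q a)) nik.
- have [muD [C hC]] := muP n; split; last by exists C.
  move=> a b ab; rewrite pi_join muD// -pi_meet ab//.
- exact: ptw.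
- by exists M => n; elim/quot_ind => a; exact: hM.
Qed.

Variable lam : B -> R.
Hypothesis lamD : finitely_additive lam.
Hypothesis lam0 : forall a, I a -> lam a = 0.

(** Both elements differ from their meet by members of [I], where [lam] vanishes; so [lam] descends
    to the quotient. *)
Lemma quotient_charge_repr (a : B) : lam (repr (\pi_Q a)) = lam a.
Proof.
have [h1 h2] := quot_repr idI a.
rewrite [LHS](charge_diff _ a lamD) [RHS](charge_diff _ (repr (\pi_Q a)) lamD).
by rewrite (lam0 h1) (lam0 h2) !addr0 meetC.
Qed.

(** Disjoint classes only have representatives whose meet lies in [I]. Removing that meet from [b]
    makes them disjoint and leaves [lam b] unchanged. *)
Lemma quotient_charge_additive : finitely_additive (lam \o (@repr _ Q)).
Proof.
move=> x y; elim/quot_ind: x => a; elim/quot_ind: y => b.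
rewrite -pi_meet -pi_join /= !quotient_charge_repr => ab.
have Iab : I (a `&` b)%O.
  have /eqP/quot_eqP[+ _] : \pi_Q (a `&` b)%O = \pi_Q \bot%O by rewrite ab.
  by rewrite diffx0.
rewrite [lam b](charge_diff _ a lamD) (lam0 (a := (b `&` a)%O)) 1?meetC//.
rewrite add0r -lamD ?diffKU//.
by rewrite diffE meetCA meetxC meetx0.
Qed.

End quotient_charge.

(** * Finitely supported measures *)

Lemma indicU_disjoint (R : realType) (T : Type) (A B : set T) (x : T) :
  A `&` B = set0 -> \1_(A `|` B) x = \1_A x + \1_B x :> R.
Proof.
move=> AB; rewrite !indicE in_setU.
have [xA|_] /= := boolP (x \in A); last by rewrite add0r.
have [xB|_] /= := boolP (x \in B); last by rewrite addr0.
have : (A `&` B) x by split; exact: set_mem.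
by rewrite AB.
Qed.

Section fs_measure_lemmas.
Context (R : realType) (X : topologicalType).
Implicit Types (S : {fset X}) (alpha : X -> R) (A B : set X).

Lemma fs_measureU S alpha A B : A `&` B = set0 ->
  fs_measure S alpha (A `|` B) = fs_measure S alpha A + fs_measure S alpha B.
Proof.
move=> AB; rewrite /fs_measure -big_split; apply: eq_bigr => x _ /=.
by rewrite -mulrDr indicU_disjoint.
Qed.

Lemma ler_fs_measure S alpha A : `|fs_measure S alpha A| <= fs_norm S alpha.
Proof.
apply: (le_trans (ler_norm_sum _ _ _)); apply: ler_sum => x _.
rewrite normrM -[leRHS]mulr1 ler_wpM2l// indicE.
by case: (x \in A); rewrite ?normr0 ?normr1.
Qed.

(** A Hahn decomposition in which [A] is prescribed only on the support, leaving room to choose it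
    clopen. *)
Lemma fs_norm_sign_split S alpha A :
  (forall x, x \in S -> A x <-> 0 < alpha x) ->
  fs_norm S alpha = fs_measure S alpha A - fs_measure S alpha (~` A).
Proof.
move=> AP; rewrite /fs_norm /fs_measure -sumrB; apply: eq_big_seq => x xS.
rewrite !indicE in_setC; have [/set_mem|/negP nA] /= := boolP (x \in A).
  by move=> /(AP x xS) a0; rewrite mulr1 mulr0 subr0 gtr0_norm.
rewrite mulr1 mulr0 sub0r ler0_norm// leNgt; apply/negP => /(AP x xS) h.
by apply: nA; exact: mem_set.
Qed.

End fs_measure_lemmas.

(** * Free filters and the clopen sets of the filter space *)

Section free_filter.
Context (F : set_system nat) (FF : ProperFilter F).
Hypothesis freeF : \bigcap_(A in F) A = set0.
Local Notation X := (filter_space FF).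
Local Notation AF := (filter_algebra FF).

Lemma free_filter_cofinite (S : set nat) : finite_set S -> F (~` S).
Proof.
move=> /finite_fsetP[D ->].
have -> : ~` [set` D] = \bigcap_(i in [set` D]) ~` [set i].
  rewrite -setC_bigcup; congr (~` _).
  by apply/seteqP; split=> [i iD|i [j jD ->]//]; exists i.
apply: filter_bigI => i _; apply: contrapT => nFi.
have : (\bigcap_(A in F) A) i.
  move=> A FA; apply: contrapT => nAi; apply: nFi.
  by apply: filterS FA => j Aj ji; apply: nAi; rewrite -ji.
by rewrite freeF.
Qed.

(** Total, so that it can be composed with set operations; outside the algebra the value is the
    default [\bot], whence the membership hypotheses below. *)
Definition filter_elt (A : set nat) : AF := insubd (\bot%O : AF) A.

Lemma val_filter_elt A : filter_or_dual F A -> val (filter_elt A) = A.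
Proof. by move=> FA; rewrite insubdK//; exact: mem_set. Qed.

(** Supplies the full power sets on which [charge_bounded_finite] operates. *)
Lemma filter_or_dual_sub A B : F A -> B `<=` ~` A -> filter_or_dual F B.
Proof.
move=> FA BA; right; exists (~` B); last by rewrite setCK.
by apply: filterS FA => x Ax /BA.
Qed.

Lemma filter_or_dual_finite S : finite_set S -> filter_or_dual F S.
Proof.
move=> /free_filter_cofinite FS; apply: (filter_or_dual_sub FS).
by rewrite setCK.
Qed.

Lemma filter_eltU A B : filter_or_dual F A -> filter_or_dual F B ->
  filter_elt (A `|` B) = (filter_elt A `|` filter_elt B)%O.
Proof.
move=> FA FB; apply: val_inj.
rewrite -[RHS]/(val (filter_elt A) `|` val (filter_elt B)).
rewrite !val_filter_elt// -[A `|` B]setCK setCU; apply: filter_or_dualC.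
by apply: filter_or_dualI; exact: filter_or_dualC.
Qed.

Lemma filter_elt_disjoint A B : filter_or_dual F A -> filter_or_dual F B ->
  A `&` B = set0 -> (filter_elt A `&` filter_elt B = \bot)%O.
Proof.
move=> FA FB AB; apply: val_inj.
by rewrite -[LHS]/(val (filter_elt A) `&` val (filter_elt B)) !val_filter_elt.
Qed.

(** The points of omega are isolated, so openness is a condition at [None] only and is void for sets
    missing it. Of [U] and its complement, just one is constrained. *)
Lemma filter_space_clopen (U : set X) : clopen U <->
  (U None /\ F (Some @^-1` U)) \/ (~ U None /\ F (~` (Some @^-1` U))).
Proof.
have half (V : set X) : V None -> (open V <-> F (Some @^-1` V)).
  move=> VN; rewrite openE; split=> [/(_ _ VN) [A FA AV]|FV [k|] Vx].
  - by apply: filterS FA => k Ak; apply: AV; left; exists k.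
  - exact: Vx.
  - by exists (Some @^-1` V) => // _ [[k Vk <-]|->].
have triv (V : set X) : ~ V None -> open V.
  by move=> VN; rewrite openE => -[k|//].
have [UN|UN] := pselect (U None).
  split=> [[/(half _ UN) FU _]|[[_ /(half _ UN) oU]|[//]]]; first by left.
  by split=> //; rewrite -openC; apply: triv => /(_ UN).
split=> [[_]|[[//]|[_ FU]]].
  by rewrite -openC => /(half (~` U) UN) FU; right.
split; first exact: triv.
by rewrite -openC; apply/(half (~` U) UN).
Qed.

Definition filter_clopen (a : AF) : set X :=
  [set x | if x is Some k then val a k else F (val a)].

Lemma filter_clopen_clopen a : clopen (filter_clopen a).
Proof.
apply/filter_space_clopen; rewrite /filter_clopen /=.
have [Fa|nFa] := pselect (F (val a)); [by left|right; split=> //].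
have [//|[A FA Aa]] := set_mem (valP a).
by rewrite -[val a]Aa setCK.
Qed.

Lemma filter_clopen_surj U : clopen U -> exists a, U = filter_clopen a.
Proof.
move=> /filter_space_clopen UP; pose A := Some @^-1` U.
have FA : filter_or_dual F A.
  by case: UP => [[_]|[_ FU]]; [left|right; exists (~` A) => //; exact: setCK].
exists (filter_elt A); rewrite /filter_clopen val_filter_elt//.
apply/seteqP; split=> [[k|]|[k|]] //=; case: UP => -[UN FU] //.
move=> FA'; have : F (A `&` ~` A) by exact: filterI.
by rewrite setICr => /filter_not_empty.
Qed.

Lemma filter_clopen_disjoint a b : (a `&` b = \bot)%O ->
  filter_clopen a `&` filter_clopen b = set0.
Proof.
move=> /(congr1 val) /= ab; have {}ab : val a `&` val b = set0 by exact: ab.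
rewrite -subset0 => -[k|] [] /=.
  by move=> ak bk; have : (val a `&` val b) k by []; rewrite ab.
move=> Fa Fb; have : F (val a `&` val b) by exact: filterI.
by rewrite ab => /filter_not_empty.
Qed.

Lemma filter_clopen_join a b :
  filter_clopen (a `|` b)%O = filter_clopen a `|` filter_clopen b.
Proof.
have vU : val (a `|` b)%O = val a `|` val b by [].
rewrite /filter_clopen vU; apply/seteqP; split=> -[k|] //=; last first.
  by case; apply: filterS; [exact: subsetUl|exact: subsetUr].
(* [F] need not be an ultrafilter but is prime on the algebra: if [val a] is the complement of a
   member [A] of [F], intersecting the union with [A] leaves a subset of [val b]. *)
move=> Fab; have [Fa|[A FA Aa]] := set_mem (valP a); first by left.
right; apply: filterS (filterI FA Fab) => k [Ak [|//]].
by rewrite -[val a]Aa.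
Qed.

Lemma fs_Nikodym_of_Nikodym (R : realType) :
  Nikodym_property R AF -> fs_Nikodym_property R X.
Proof.
move=> nik S alpha h.
have ptw a : exists M : R, forall n,
    `|fs_measure (S n) (alpha n) (filter_clopen a)| <= M.
  have /cvgP/cvg_seq_bounded[C [_ hC]] := h _ (filter_clopen_clopen a).
  by exists (C + 1) => n; apply: hC => //; rewrite ltrDl.
have [|M hM] := Nikodym_bounded nik _ ptw.
  move=> n; split=> [a b ab|].
    by rewrite filter_clopen_join fs_measureU//; exact: filter_clopen_disjoint.
  by exists (fs_norm (S n) (alpha n)) => a; exact: ler_fs_measure.
have {}hM n U : clopen U -> `|fs_measure (S n) (alpha n) U| <= M.
  by move=> /filter_clopen_surj[a ->].
exists (M + M) => n.
have fin_clopen (V : set X) : V `<=` [set` S n] -> ~ V None -> clopen V.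
  move=> VS VN; apply/filter_space_clopen; right; split=> //.
  apply: free_filter_cofinite; apply: finite_preimage.
    by move=> i j _ _ [].
  by apply: sub_finite_set VS _; exact: finite_fset.
suff [U cU UP] : exists2 U, clopen U &
    forall x, x \in S n -> U x <-> 0 < alpha n x.
  rewrite (fs_norm_sign_split UP).
  have := hM n U cU; have := hM n (~` U) (clopenC set0 cU).
  by rewrite !ler_norml => /andP[? ?] /andP[? ?]; lra.
(* A finite set is clopen only if it misses [None]. When [None] has positive mass, the finite set of
   nonpositive support points is taken and complemented instead. *)
have [aN|aN] := pselect (0 < alpha n None).
  exists (~` [set x | x \in S n /\ ~ 0 < alpha n x]).
    by apply: (clopenC set0); apply: fin_clopen => [x []|[]].
  by move=> x xS; split=> [/= /not_andP[//|/contrapT]|ax []].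
exists [set x | x \in S n /\ 0 < alpha n x].
  by apply: fin_clopen => [x []//|[]].
by move=> x xS; split=> [[]|].
Qed.

End free_filter.

(** * Atomic charges with summable masses *)

Section atomic_part.
Context (R : realType) (a : nat -> R) (C : R).
Hypothesis aC : forall N, \sum_(0 <= k < N) `|a k| <= C.

(** The limit is meaningful when the series converges, which [is_cvg_atomic_series] derives from
    [aC]. *)
Definition atomic_charge (A : set nat) : R :=
  limn (series (fun k => a k * \1_A k)).

Lemma normr_atomic_term A k : `|a k * \1_A k| <= `|a k|.
Proof.
rewrite normrM -[leRHS]mulr1 ler_wpM2l// indicE.
by case: (k \in A); rewrite ?normr0 ?normr1.
Qed.

Lemma is_cvg_atomic_series A : cvgn (series (fun k => a k * \1_A k)).
Proof.
apply: normed_cvg; apply: nondecreasing_is_cvgn.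
  by apply: nondecreasing_series => k _ _; exact: normr_ge0.
exists C => _ [N _ <-]; apply: le_trans (aC N).
by apply: ler_sum => k _; exact: normr_atomic_term.
Qed.

Lemma normr_atomic_charge A : `|atomic_charge A| <= C.
Proof.
have sC N : `|series (fun k => a k * \1_A k) N| <= C.
  apply: le_trans (aC N); apply: (le_trans (ler_norm_sum _ _ _)).
  by apply: ler_sum => k _; exact: normr_atomic_term.
rewrite ler_norml; apply/andP; split.
  apply: limr_ge; first exact: is_cvg_atomic_series.
  by apply: nearW => N; have := sC N; rewrite ler_norml => /andP[].
apply: limr_le; first exact: is_cvg_atomic_series.
by apply: nearW => N; have := sC N; rewrite ler_norml => /andP[].
Qed.

Lemma atomic_chargeU A B : A `&` B = set0 ->
  atomic_charge (A `|` B) = atomic_charge A + atomic_charge B.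
Proof.
move=> AB; rewrite -lim_seriesD; [|exact: is_cvg_atomic_series..].
congr (limn (series _)); apply/funext => k /=.
rewrite -[RHS]/(a k * \1_A k + a k * \1_B k) -mulrDr.
by rewrite indicU_disjoint.
Qed.

Lemma atomic_charge_finite A N : A `<=` `I_N ->
  atomic_charge A = \sum_(0 <= k < N) a k * \1_A k.
Proof.
move=> AN; apply: cvg_lim => //.
apply: (@cvg_trans _ ((fun=> \sum_(0 <= k < N) a k * \1_A k) @ \oo)).
  apply: near_eq_cvg; near=> n; rewrite /series/=.
  have Nn : (N <= n)%N by near: n; exists N.
  have s0 : \sum_(N <= k < n) a k * \1_A k = 0; last first.
    by rewrite [RHS](big_cat_nat _ Nn)//= s0 addr0.
  rewrite big_nat_cond big1//.
  move=> k /andP[/andP[Nk _] _]; rewrite indicE memNset ?mulr0// => /AN /=.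
  by rewrite ltnNge Nk.
exact: cvg_cst.
Unshelve. all: by end_near. Qed.

End atomic_part.

(** * From the quotient and the filter space back to the algebra *)

Section Nikodym_converse.
Context (R : realType) (F : set_system nat) (FF : ProperFilter F).
Hypothesis freeF : \bigcap_(A in F) A = set0.
Local Notation X := (filter_space FF).
Local Notation AF := (filter_algebra FF).
Local Notation elt := (filter_elt FF).

Lemma charge_atoms (mu : AF -> R) (A : set nat) (N : nat) :
  finitely_additive mu ->
  mu (elt (A `&` `I_N)) = \sum_(0 <= k < N) mu (elt [set k]) * \1_A k.
Proof.
move=> muD; have fII B n : filter_or_dual F (B `&` `I_n).
  by apply: filter_or_dual_finite => //; apply: finite_setIr; exact: finite_II.
have f1 k : filter_or_dual F [set k].
  by apply: filter_or_dual_finite => //; exact: finite_set1.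
elim: N => [|N IH].
  rewrite II0 setI0 big_nil -(charge_bot muD); congr mu; apply: val_inj.
  by rewrite val_filter_elt//; have := fII set0 0; rewrite set0I.
rewrite big_nat_recr//= -IH IIS setIUr indicE.
have [/set_mem AN|/negP nAN] := boolP (N \in A).
  have -> : A `&` [set N] = [set N] by apply/setIidr => _ ->.
  rewrite mulr1 filter_eltU// muD//; apply: filter_elt_disjoint => //.
  by rewrite -subset0 => k [[_ /=]] + kN; rewrite kN ltnn.
have -> : A `&` [set N] = set0.
  by rewrite -subset0 => k [Ak kN]; apply: nAN; rewrite -kN; exact: mem_set.
by rewrite setU0 mulr0 addr0.
Qed.

Context (mu : nat -> AF -> R).
Hypothesis muP : forall n, finitely_additive (mu n) /\ bounded_function (mu n).
Hypothesis ptw : forall a, exists M : R, forall n, `|mu n a| <= M.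

(** Intersecting with the complement of [A] turns every [mu n] into a charge on the whole power set
    of the naturals. *)
Lemma charge_bounded_finite_dual (A : set nat) : F A ->
  exists M : R, forall n S, finite_set S -> S `<=` ~` A ->
    `|mu n (elt S)| <= M.
Proof.
move=> FA; pose m n B := mu n (elt (~` A `&` B)).
have fA B : filter_or_dual F (~` A `&` B).
  by apply: (filter_or_dual_sub FF FA); exact: subIsetl.
have [n B C BC|n|B|M hM] := @charge_bounded_finite R m.
- have {}BC : B `&` C = set0 := BC.
  rewrite /m -[(B `|` C)%O]/(B `|` C) setIUr filter_eltU// (muP n).1//.
  by apply: filter_elt_disjoint => //; rewrite setIACA BC setI0.
- by have [_ [M hM]] := muP n; exists M => B; exact: hM.
- by have [M hM] := ptw (elt (~` A `&` B)); exists M => n; exact: hM.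
- by exists M => n S fS SA; have := hM n S fS; rewrite /m (setIidr SA).
Qed.

Let atom n k := mu n (elt [set k]).

Let support (N : nat) : {fset X} := seq_fset tt (None :: map Some (iota 0 N)).

(* The point [None] compensates the total mass, so that on a clopen set
   containing [None] the measure is minus its value on the complement. *)
Let weight (i : nat * nat) (x : X) : R :=
  if x is Some k then atom i.1 k else - \sum_(0 <= k < i.2) atom i.1 k.

Let big_support (f : X -> R) N :
  \sum_(x <- support N) f x = f None + \sum_(0 <= k < N) f (Some k).
Proof.
rewrite (perm_big _ (seq_fset_perm tt _)) undup_id; last first.
  rewrite /= map_inj_uniq ?iota_uniq ?andbT; last by move=> i j [].
  by apply/mapP => -[].
by rewrite big_cons big_map /index_iota subn0.
Qed.

Lemma atoms_bounded : fs_Nikodym_property R X ->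
  exists C : R, forall n N, \sum_(0 <= k < N) `|atom n k| <= C.
Proof.
(* On a clopen set missing [None] the truncated measure is [mu n] of a finite set disjoint from a
   fixed member of [F], hence bounded uniformly in [n] and in the truncation. *)
move=> nik; have Ndual (U : set X) : ~ U None -> clopen U ->
    exists M : R, forall i, `|fs_measure (support i.2) (weight i) U| <= M.
  move=> UN /filter_space_clopen[[]//|[_ FU]].
  have [M hM] := charge_bounded_finite_dual FU; exists M => -[n N].
  rewrite /fs_measure big_support /= indicE memNset// mulr0 add0r.
  have -> : \sum_(0 <= k < N) atom n k * \1_U (Some k) =
      mu n (elt ((Some @^-1` U) `&` `I_N)).
    by rewrite charge_atoms//; exact: (muP n).1.
  apply: hM; first by apply: finite_setIr; exact: finite_II.
  by rewrite setCK; exact: subIsetl.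
have [U cU|C hC] := fs_Nikodym_bounded (S := fun i => support i.2)
    (alpha := weight) nik; last first.
  exists C => n N; apply: le_trans (hC (n, N)).
  by rewrite /fs_norm big_support /= lerDr.
have [UN|/Ndual] := pselect (U None); last exact.
have [M hM] : exists M : R, forall i,
    `|fs_measure (support i.2) (weight i) (~` U)| <= M.
  by apply: Ndual; [exact|exact: (clopenC set0)].
exists M => i; apply: le_trans (hM i); rewrite -normrN.
suff -> : fs_measure (support i.2) (weight i) U =
  - fs_measure (support i.2) (weight i) (~` U) by rewrite opprK.
apply/eqP; rewrite -addr_eq0 -fs_measureU ?setICr// setUCr.
rewrite /fs_measure big_support /= indicT mulr1; apply/eqP.
under [X in _ + X]eq_bigr do rewrite mulr1.
by rewrite addNr.
Qed.

Lemma Nikodym_bounded_converse :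
  Nikodym_property R (ideal_quotient (Fin_ideal FF)) ->
  fs_Nikodym_property R X ->
  exists M : R, forall n a, `|mu n a| <= M.
Proof.
move=> nikQ /atoms_bounded[C aC].
pose nu n := atomic_charge (atom n).
have nuC n A : `|nu n A| <= C by exact: normr_atomic_charge.
(* [nu n] has the same atoms as [mu n], so the two agree on finite sets and the difference descends
   to the quotient by [Fin]. *)
pose lam n (a : AF) := mu n a - nu n (val a).
have lamD n : finitely_additive (lam n).
  move=> a b ab; rewrite /lam (muP n).1//.
  have vab : val a `&` val b = set0 by have := congr1 val ab.
  rewrite -[val (a `|` b)%O]/(val a `|` val b).
  by rewrite /nu (atomic_chargeU (aC n))//; lra.
have lam0 n a : Fin a -> lam n a = 0.
  move=> fa; have [N aN] := finite_set_sub_II fa.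
  rewrite /lam /nu (atomic_charge_finite _ aN) -charge_atoms; last first.
    exact: (muP n).1.
  rewrite (setIidl aN); apply/eqP; rewrite subr_eq0; apply/eqP.
  congr (mu n); apply: val_inj; rewrite val_filter_elt//.
  exact: filter_or_dual_finite.
have lamC n a : `|lam n a| <= `|mu n a| + C.
  by apply: (le_trans (ler_normB _ _)); rewrite lerD2l.
have [n|x|M hM] := Nikodym_bounded
    (mu := fun n => lam n \o (@repr _ (ideal_quotient (Fin_ideal FF)))) nikQ.
- split; first exact: (quotient_charge_additive (lamD n) (lam0 n)).
  have [_ [M hM]] := muP n; exists (M + C) => x.
  by apply: (le_trans (lamC _ _)); rewrite lerD2r.
- have [M hM] := ptw (repr x); exists (M + C) => n.
  by apply: (le_trans (lamC _ _)); rewrite lerD2r.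
exists (M + C) => n a.
have := hM n (\pi_(ideal_quotient (Fin_ideal FF)) a)%qT.
rewrite /= (quotient_charge_repr _ (lamD n) (lam0 n)) => h.
have -> : mu n a = lam n a + nu n (val a) by rewrite subrK.
by apply: (le_trans (ler_normD _ _)); rewrite lerD.
Qed.

End Nikodym_converse.

Theorem theoremD (R : realType) (F : set_system nat) (FF : ProperFilter F)
    (freeF : \bigcap_(A in F) A = set0) :
  Nikodym_property R (filter_algebra FF) <->
  Nikodym_property R (ideal_quotient (Fin_ideal FF)) /\
  fs_Nikodym_property R (filter_space FF).
Proof.
split=> [nik|[nikQ nikX]].
  by split; [exact: Nikodym_quotient|exact: fs_Nikodym_of_Nikodym].
apply: Nikodym_property_intro => mu muP ptw.
exact: Nikodym_bounded_converse.
Qed.
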